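(* Let $R$ be a ring, ${}'\mathcal{C}={}'\mathcal{C}_R$ and $\mathfrak{a}=\mathrm{ass}_R({}'\mathcal{C})$. The following statements are equivalent. 1. ${}'Q_{l,\mathrm{cl}}(R)$ is a semisimple Artinian ring. 2. There are left denominator sets $S_1,\ldots,S_n$ of the ring $R$ such that (a) the rings $S_i^{-1}R$ are simple Artinian rings, (b) $\mathfrak{a}=\bigcap_{i=1}^n\mathrm{ass}_R(S_i)$, and (c) $\overline{{}'\mathcal{C}}:=\{c+\mathfrak{a}\mid c\in{}'\mathcal{C}\}$ is a dense subset of $\mathcal{C}_{\overline{R}}$, where $\overline{R}:=R/\mathfrak{a}$.
   Context: Rings are associative with $1$. For a nonempty subset $S$ of a ring $R$, $\mathrm{ass}_R(S):=\{r\in R\mid sr=0\text{ for some }s\in S\}$. ${}'\mathcal{C}_R$ is the set of left regular elements of $R$: those $r\in R$ such that $xr=0$ ($x\in R$) implies $x=0$. $\mathcal{C}_R$ is the set of regular elements: those $r$ such that $xr=0$ implies $x=0$ and $rx=0$ implies $x=0$. A multiplicative set is a subset $S$ with $1\in S$, $SS\subseteq S$, $0\notin S$. It is a left Ore set if $Sr\cap Rs\neq\emptyset$ for all $r\in R$, $s\in S$. It is a left denominator set if it is left Ore and $rs=0$ with $r\in R$, $s\in S$ implies $r\in\mathrm{ass}_R(S)$; then $\mathrm{ass}_R(S)$ is an ideal and the left localization $S^{-1}R$ exists. For multiplicative sets $S\subseteq T$ of $R$, $S$ is dense in $T$ if for each $t\in T$ there is $r\in R$ with $rt\in S$. ${}'Q_{l,\mathrm{cl}}(R):={}'\mathcal{C}_R^{-1}R$;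 it exists exactly when ${}'\mathcal{C}_R$ is a left denominator set, and the assertion that it is semisimple Artinian includes the assertion that it exists. *)

(* Defs.v *)
From HB Require Import structures.
From mathcomp Require Import all_boot all_algebra.
From mathcomp Require Import boolp classical_sets.

Set Implicit Arguments.
Unset Strict Implicit.
Unset Printing Implicit Defensive.

Import GRing.Theory.
Local Open Scope classical_set_scope.
Local Open Scope ring_scope.

Section Ideals.
Variable R : pzRingType.
Implicit Types I J : set R.

Definition left_ideal I : Prop :=
  [/\ I 0, forall x y, I x -> I y -> I (x + y)
    & forall a x, I x -> I (a * x)].

Definition right_ideal I : Prop :=
  [/\ I 0, forall x y, I x -> I y -> I (x + y)
    & forall a x, I x -> I (x * a)].

Definition two_sided_ideal I : Prop := left_ideal I /\ right_ideal I.

Definition maximal_left_ideal I : Prop :=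
  [/\ left_ideal I, I <> setT
    & forall J, left_ideal J -> I `<=` J -> J = I \/ J = setT].

Definition jacobson_radical : set R :=
  \bigcap_(I in maximal_left_ideal) I.

Definition left_artinian : Prop :=
  forall I_ : nat -> set R, (forall k, left_ideal (I_ k)) ->
    (forall k, I_ k.+1 `<=` I_ k) ->
    exists m, forall k, (m <= k)%N -> I_ k = I_ m.

Definition right_artinian : Prop :=
  forall I_ : nat -> set R, (forall k, right_ideal (I_ k)) ->
    (forall k, I_ k.+1 `<=` I_ k) ->
    exists m, forall k, (m <= k)%N -> I_ k = I_ m.

Definition artinian : Prop := left_artinian /\ right_artinian.

Definition simple_ring : Prop :=
  (1 : R) <> 0 /\ forall I, two_sided_ideal I -> I = [set 0] \/ I = setT.

(* For Artinian rings "semisimple" means vanishing Jacobson radical. *)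
Definition semisimple_artinian : Prop :=
  artinian /\ jacobson_radical = [set 0].

Definition simple_artinian : Prop := artinian /\ simple_ring.

End Ideals.

Section QuotientRing.
Variables (R : pzRingType) (I : set R) (hI : two_sided_ideal I).

(* MathComp's quotients need a boolean predicate, and it builds quotient rings
   only for commutative rings: the additive quotient {quot I} is reused, and
   the noncommutative multiplication is added to it. *)
Definition ideal_pred (_ : two_sided_ideal I) : {pred R} := fun x => `[< I x >].

Lemma ideal_pred_zmod : zmod_closed (ideal_pred hI).
Proof.
have [[I0 ID IM] _] := hI; split=> [|x y Ix Iy].
  exact/asboolP.
move/asboolP: Ix => Ix; move/asboolP: Iy => Iy.
by apply/asboolP; rewrite -mulN1r; apply: ID => //; apply: IM.
Qed.

HB.instance Definition _ :=
  GRing.isZmodClosed.Build R (ideal_pred hI) ideal_pred_zmod.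

Definition quotient_ring := Quotient.quot (ideal_pred hI).
HB.instance Definition _ := GRing.Zmodule.on quotient_ring.

Definition quotient_pi (x : R) : quotient_ring := \pi_(quotient_ring)%qT x.

Lemma quotient_piP x y : quotient_pi x = quotient_pi y <-> I (x - y).
Proof.
rewrite /quotient_pi; split.
  by move/eqP; rewrite -Quotient.idealrBE => /asboolP.
by move=> Ixy; apply/eqP; rewrite -Quotient.idealrBE; apply/asboolP.
Qed.

Lemma quotient_pi_surj (q : quotient_ring) : exists x, quotient_pi x = q.
Proof. by exists (repr q); rewrite /quotient_pi reprK. Qed.

Definition quotient_one : quotient_ring := quotient_pi 1.

Definition quotient_mul (p q : quotient_ring) : quotient_ring :=
  quotient_pi (repr p * repr q).

Lemma quotient_piM x y :
  quotient_pi (x * y) = quotient_mul (quotient_pi x) (quotient_pi y).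
Proof.
apply/quotient_piP; set x' := repr _; set y' := repr _.
have [Ix Iy] : I (x - x') /\ I (y - y').
  by split; apply/quotient_piP; rewrite /quotient_pi reprK.
have -> : x * y - x' * y' = (x - x') * y + x' * (y - y').
  by rewrite mulrBl mulrBr addrA subrK.
have [[_ ID IL] [_ _ IR]] := hI.
by apply: ID; [apply: IR | apply: IL].
Qed.

Lemma quotient_piD x y :
  quotient_pi (x + y) = quotient_pi x + quotient_pi y.
Proof. by rewrite /quotient_pi piE. Qed.

Lemma quotient_mulA : associative quotient_mul.
Proof.
move=> p q r.
have [[x <-] [y <-] [z <-]] := And3 (quotient_pi_surj p)
  (quotient_pi_surj q) (quotient_pi_surj r).
by rewrite -!quotient_piM mulrA.
Qed.

Lemma quotient_mul1l : left_id quotient_one quotient_mul.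
Proof.
by move=> p; have [x <-] := quotient_pi_surj p; rewrite -quotient_piM mul1r.
Qed.

Lemma quotient_mul1r : right_id quotient_one quotient_mul.
Proof.
by move=> p; have [x <-] := quotient_pi_surj p; rewrite -quotient_piM mulr1.
Qed.

Lemma quotient_mulDl : left_distributive quotient_mul +%R.
Proof.
move=> p q r.
have [[x <-] [y <-] [z <-]] := And3 (quotient_pi_surj p)
  (quotient_pi_surj q) (quotient_pi_surj r).
by rewrite -quotient_piD -!quotient_piM mulrDl quotient_piD.
Qed.

Lemma quotient_mulDr : right_distributive quotient_mul +%R.
Proof.
move=> p q r.
have [[x <-] [y <-] [z <-]] := And3 (quotient_pi_surj p)
  (quotient_pi_surj q) (quotient_pi_surj r).
by rewrite -quotient_piD -!quotient_piM mulrDr quotient_piD.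
Qed.

HB.instance Definition _ := GRing.Zmodule_isPzRing.Build quotient_ring
  quotient_mulA quotient_mul1l quotient_mul1r quotient_mulDl quotient_mulDr.

Lemma quotient_pi_is_zmod_morphism : zmod_morphism quotient_pi.
Proof. by move=> x y; rewrite /quotient_pi piE. Qed.

Lemma quotient_pi_is_monoid_morphism : monoid_morphism quotient_pi.
Proof. by split=> // x y; rewrite quotient_piM. Qed.

HB.instance Definition _ := GRing.isZmodMorphism.Build R quotient_ring
  quotient_pi quotient_pi_is_zmod_morphism.
HB.instance Definition _ := GRing.isMonoidMorphism.Build R quotient_ring
  quotient_pi quotient_pi_is_monoid_morphism.

End QuotientRing.

Section Localization.
Variable R : pzRingType.
Implicit Types (S T : set R) (r s t : R).

Definition ass S : set R := [set r | exists2 s, S s & s * r = 0].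

(* MathComp's GRing.rreg states this condition as injectivity of x |-> x * r. *)
Definition left_regular : set R := [set r | forall x, x * r = 0 -> x = 0].

Definition regular : set R :=
  [set r | (forall x, x * r = 0 -> x = 0) /\ (forall x, r * x = 0 -> x = 0)].

Definition multiplicative_set S : Prop :=
  [/\ S 1, forall s t, S s -> S t -> S (s * t) & ~ S 0].

Definition left_ore S : Prop :=
  multiplicative_set S /\
  forall r s, S s ->
    [set s' * r | s' in S] `&` [set r' * s | r' in setT] !=set0.

Definition left_denominator_set S : Prop :=
  left_ore S /\ forall r s, S s -> r * s = 0 -> ass S r.

Definition dense S T : Prop :=
  [/\ multiplicative_set S, multiplicative_set T, S `<=` T
    & forall t, T t -> exists r, S (r * t)].

Definition mutually_inverse (Q : pzRingType) (u v : Q) : Prop :=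
  u * v = 1 /\ v * u = 1.

(* f : R -> Q exhibits Q as S^-1 R: the elements of S become invertible, every
   element of Q is a left fraction (f s)^-1 * f r, and ker f = ass S.  For a
   left denominator set such a pair (Q, f) exists, and it is unique up to
   isomorphism by left_localization_unique below. *)
Definition is_left_localization S (Q : pzRingType) (f : {rmorphism R -> Q}) :
    Prop :=
  [/\ forall s, S s -> exists v, mutually_inverse (f s) v,
      forall q, exists s r v,
        [/\ S s, mutually_inverse (f s) v & q = v * f r]
    & forall r, f r = 0 <-> ass S r].

(* "S^-1 R has property P", including the assertion that S^-1 R exists. *)
Definition left_localization_satisfies S (P : pzRingType -> Prop) : Prop :=
  left_denominator_set S /\
  exists (Q : pzRingType) (f : {rmorphism R -> Q}),
    is_left_localization S f /\ P Q.

Definition same_fraction S (Q1 Q2 : pzRingType)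
    (f1 : {rmorphism R -> Q1}) (f2 : {rmorphism R -> Q2}) q1 q2 : Prop :=
  exists s r, [/\ S s, f1 s * q1 = f1 r & f2 s * q2 = f2 r].

Lemma left_ore_pair S r s : left_ore S -> S s ->
  exists s' r', S s' /\ s' * r = r' * s.
Proof.
move=> [_ ore] /(ore r)[x [[s' Ss' <-]] [r' _ e]].
by exists s', r'.
Qed.

Lemma left_localization_cancel S (Q : pzRingType) (f : {rmorphism R -> Q}) :
  is_left_localization S f ->
  forall s x y, S s -> f s * x = f s * y -> x = y.
Proof.
move=> [inv _ _] s x y /inv[v [_ vs]] e.
by rewrite -[x]mul1r -[y]mul1r -vs -!mulrA e.
Qed.

Lemma same_fraction_total S (Q1 Q2 : pzRingType)
    (f1 : {rmorphism R -> Q1}) (f2 : {rmorphism R -> Q2}) :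
  is_left_localization S f1 -> is_left_localization S f2 ->
  forall q1, exists q2, same_fraction S f1 f2 q1 q2.
Proof.
move=> [_ frac1 _] [inv2 _ _] q1.
have [s [r [v [Ss [sv _] ->]]]] := frac1 q1.
have [w [sw _]] := inv2 s Ss.
by exists (w * f2 r), s, r; rewrite !mulrA sv sw !mul1r.
Qed.

Lemma same_fraction_functional S (Q1 Q2 : pzRingType)
    (f1 : {rmorphism R -> Q1}) (f2 : {rmorphism R -> Q2}) :
  left_denominator_set S ->
  is_left_localization S f1 -> is_left_localization S f2 ->
  forall x y z,
    same_fraction S f1 f2 x y -> same_fraction S f1 f2 x z -> y = z.
Proof.
move=> [ore _] L1 L2 x y z [s [r [Ss e1 e2]]] [t [u [St e3 e4]]].
have [s' [r' [Ss' e]]] := left_ore_pair s ore St.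
have Sss : S (s' * s) by case: ore => -[_ SM _] _; apply: SM.
apply: (left_localization_cancel L2 Sss).
rewrite {2}e !rmorphM -!mulrA e2 e4 -!rmorphM.
apply/eqP; rewrite -subr_eq0 -rmorphB; apply/eqP.
case: L2 => _ _ ->; case: L1 => _ _ <-.
by rewrite rmorphB !rmorphM -e1 -e3 !mulrA -!rmorphM e subrr.
Qed.

Lemma same_fraction_sym S (Q1 Q2 : pzRingType)
    (f1 : {rmorphism R -> Q1}) (f2 : {rmorphism R -> Q2}) q1 q2 :
  same_fraction S f1 f2 q1 q2 -> same_fraction S f2 f1 q2 q1.
Proof. by move=> [s [r [Ss e1 e2]]]; exists s, r. Qed.

Lemma same_fractionB S (Q1 Q2 : pzRingType)
    (f1 : {rmorphism R -> Q1}) (f2 : {rmorphism R -> Q2}) x1 x2 y1 y2 :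
  left_ore S -> same_fraction S f1 f2 x1 x2 -> same_fraction S f1 f2 y1 y2 ->
  same_fraction S f1 f2 (x1 - y1) (x2 - y2).
Proof.
move=> ore [s [r [Ss e1 e2]]] [t [u [St e3 e4]]].
have [s' [r' [Ss' e]]] := left_ore_pair s ore St.
exists (s' * s), (s' * r - r' * u); split.
- by case: ore => -[_ SM _] _; apply: SM.
- by rewrite mulrBr {2}e rmorphB !rmorphM -!mulrA e1 e3.
- by rewrite mulrBr {2}e rmorphB !rmorphM -!mulrA e2 e4.
Qed.

Lemma same_fractionM S (Q1 Q2 : pzRingType)
    (f1 : {rmorphism R -> Q1}) (f2 : {rmorphism R -> Q2}) x1 x2 y1 y2 :
  left_ore S -> same_fraction S f1 f2 x1 x2 -> same_fraction S f1 f2 y1 y2 ->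
  same_fraction S f1 f2 (x1 * y1) (x2 * y2).
Proof.
move=> ore [s [r [Ss e1 e2]]] [t [u [St e3 e4]]].
have [t' [r' [St' e]]] := left_ore_pair r ore St.
exists (t' * s), (r' * u); split.
- by case: ore => -[_ SM _] _; apply: SM.
- rewrite mulrA rmorphM -[_ * x1]mulrA e1 -rmorphM e.
  by rewrite !rmorphM -mulrA e3.
- rewrite mulrA rmorphM -[_ * x2]mulrA e2 -rmorphM e.
  by rewrite !rmorphM -mulrA e4.
Qed.

Lemma same_fraction_image S (Q1 Q2 : pzRingType)
    (f1 : {rmorphism R -> Q1}) (f2 : {rmorphism R -> Q2}) r :
  left_ore S -> same_fraction S f1 f2 (f1 r) (f2 r).
Proof. by move=> [[S1 _ _] _]; exists 1, r; rewrite !rmorph1 !mul1r. Qed.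

Lemma left_localization_unique S (Q1 Q2 : pzRingType)
    (f1 : {rmorphism R -> Q1}) (f2 : {rmorphism R -> Q2}) :
  left_denominator_set S ->
  is_left_localization S f1 -> is_left_localization S f2 ->
  exists g : {rmorphism Q1 -> Q2}, bijective g /\ forall r, g (f1 r) = f2 r.
Proof.
move=> D L1 L2; have [ore _] := D.
have [g gP] := choice (same_fraction_total L1 L2).
have [h hP] := choice (same_fraction_total L2 L1).
have gU x y : same_fraction S f1 f2 x y -> g x = y.
  exact: same_fraction_functional D L1 L2 _ _ _ (gP x).
have hU x y : same_fraction S f2 f1 x y -> h x = y.
  exact: same_fraction_functional D L2 L1 _ _ _ (hP x).
have gB : zmod_morphism g by move=> x y; apply/gU/same_fractionB.
have gM : monoid_morphism g.
  split=> [|x y]; last exact/gU/same_fractionM.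
  by apply: gU; rewrite -(rmorph1 f1) -(rmorph1 f2); apply: same_fraction_image.
pose gB' := GRing.isZmodMorphism.Build Q1 Q2 g gB.
pose gM' := GRing.isMonoidMorphism.Build Q1 Q2 g gM.
pose g' : {rmorphism Q1 -> Q2} := HB.pack g gB' gM'.
exists g'; split; last by move=> r; apply/gU/same_fraction_image.
by exists h => x; [apply: hU | apply: gU]; apply: same_fraction_sym.
Qed.

End Localization.

(* Main.v *)
From HB Require Import structures.
Require Import Defs.
From mathcomp Require Import all_boot all_algebra.
From mathcomp Require Import boolp classical_sets.

Set Implicit Arguments.
Unset Strict Implicit.
Unset Printing Implicit Defensive.

Import GRing.Theory.
Local Open Scope classical_set_scope.
Local Open Scope ring_scope.

(** Write C for the set of left regular elements and a = ass C.

    Suppose that Q = C^-1 R is semisimple Artinian, with f : R -> Q.  Then Q is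
    the product of its simple factors Q / M, where M runs through finitely many
    maximal two-sided ideals with intersection 0, and the sought denominator
    sets are the preimages S of the units of Q / M.  Everything except the
    identity ker (R -> Q / M) = ass S is inherited from Q.  For that identity, M
    has a left identity e ([semisimple_ideal_identity]); clearing the
    denominator of 1 - e gives an element of R whose image in Q is invertible
    modulo M and kills M.  In a left Artinian ring a left regular element is a
    unit, so an element of R that is regular modulo a becomes a unit of Q, and
    writing its inverse as a fraction gives density.

    Conversely, let f_i : R -> Q_i be the localizations at the S_i, and discard
    indices until the intersection of the ass (S_i) is irredundant.  The
    intersection B_i of the other kernels is then a two-sided ideal with nonzero
    image in Q_i.  The fractions with numerators in B_i form a nonzero ideal of
    the simple ring Q_i, two-sided thanks to the Artinian condition, so B_i
    contains an element b_i invertible in Q_i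
    ([simple_localization_ideal_meets]).  The b_i serve as orthogonal
    quasi-idempotents: they glue fractions in the Q_i into a single fraction of
    elements of R, so that the product of the Q_i is a ring of left fractions of
    R / a ([prod_ring_map_fraction]).  The product is semisimple Artinian, so
    the elements of C, being regular modulo a, are invertible in it, and density
    allows every denominator to be chosen in C.  Hence the product is C^-1 R. *)

(** * Ideals in left Artinian rings *)

Section LeftIdeals.
Variable R : pzRingType.
Implicit Types (I J : set R) (x y : R).

Lemma left_idealB I x y : left_ideal I -> I x -> I y -> I (x - y).
Proof.
move=> [_ ID IM] Ix Iy; apply: ID => //.
by rewrite -mulN1r; apply: IM.
Qed.

Lemma left_ideal_sum I (T : Type) (r : seq T) (F : T -> R) :
  left_ideal I -> (forall t, I (F t)) -> I (\sum_(t <- r) F t).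
Proof. by move=> [I0 ID _] IF; apply: big_ind. Qed.

Lemma left_ideal_setT I : left_ideal I -> I 1 -> I = setT.
Proof.
by move=> [_ _ IM] I1; rewrite -subTset => x _; rewrite -[x]mulr1; apply: IM.
Qed.

Lemma left_idealI I J : left_ideal I -> left_ideal J -> left_ideal (I `&` J).
Proof.
move=> [I0 ID IM] [J0 JD JM]; split=> //.
- by move=> x y [Ix Jx] [Iy Jy]; split; [apply: ID|apply: JD].
- by move=> a x [Ix Jx]; split; [apply: IM|apply: JM].
Qed.

Lemma two_sided_idealI I J :
  two_sided_ideal I -> two_sided_ideal J -> two_sided_ideal (I `&` J).
Proof.
move=> [lI [_ _ IM]] [lJ [_ _ JM]].
have [K0 KD KM] := left_idealI lI lJ; do 2!split=> //.
by move=> a x [Ix Jx]; split; [apply: IM|apply: JM].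
Qed.

Lemma two_sided_ideal_bigcap (T : Type) (F : T -> set R) :
  (forall t, two_sided_ideal (F t)) -> two_sided_ideal (\bigcap_t F t).
Proof.
move=> tF; have cap0 : (\bigcap_t F t) 0 by move=> t _; have [[]] := tF t.
have capD x y :
    (\bigcap_t F t) x -> (\bigcap_t F t) y -> (\bigcap_t F t) (x + y).
  move=> Fx Fy t tT; have [[_ FD _] _] := tF t.
  by apply: FD; [apply: Fx|apply: Fy].
split; split=> // a x Fx t tT; have [[_ _ FL] [_ _ FR]] := tF t.
  by apply/FL/Fx.
by apply/FR/Fx.
Qed.

Lemma maximal_left_ideal_unit_sum I x :
  maximal_left_ideal I -> ~ I x -> exists a i, I i /\ a * x + i = 1.
Proof.
move=> [lI _ Imax] nIx; have [I0 ID IM] := lI.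
pose J := [set y | exists a i, I i /\ a * x + i = y].
have lJ : left_ideal J.
  split.
  - by exists 0, 0; rewrite mul0r addr0.
  - move=> _ _ [a [i [Ii <-]]] [b [j [Ij <-]]]; exists (a + b), (i + j).
    by split; [apply: ID|rewrite mulrDl addrACA].
  - move=> c _ [a [i [Ii <-]]]; exists (c * a), (c * i).
    by split; [apply: IM|rewrite mulrDr mulrA].
have IJ : I `<=` J by move=> i Ii; exists 0, i; rewrite mul0r add0r.
have [JI|JT] := Imax J lJ IJ; last by have : J 1 by rewrite JT.
by case: nIx; rewrite -JI; exists 1, 0; rewrite mul1r addr0.
Qed.

(** Otherwise choice produces an infinite strictly decreasing chain. *)
Lemma left_artinian_minimal (P : set R -> Prop) :
  left_artinian R -> (forall I, P I -> left_ideal I) -> (exists I, P I) ->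
  exists I, P I /\ forall J, P J -> J `<=` I -> I `<=` J.
Proof.
move=> art Pl [I0 P0]; apply: contrapT => nomin.
have step (I : {I | P I}) :
    exists J : {J | P J}, sval J `<=` sval I /\ ~ (sval I `<=` sval J).
  case: I => I PI; apply: contrapT => nJ; apply: nomin.
  exists I; split=> // J PJ JI; apply: contrapT => nIJ.
  by apply: nJ; exists (exist _ J PJ).
have [g gP] := choice step.
pose I_ k := iter k g (exist _ I0 P0).
have [m /(_ _ (leqnSn m)) e] := art (fun k => sval (I_ k))
  (fun k => Pl _ (svalP (I_ k))) (fun k => (gP (I_ k)).1).
by have [_] := gP (I_ m); apply; rewrite -[X in X `<=` _]e.
Qed.

(** The chain of left ideals [R u^k] stabilizes, which gives
    [u^k = q u^(k+1)]; cancelling [u^k] on the right yields [q u = 1]. *)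
Lemma left_artinian_left_regular_unit (u : R) :
  left_artinian R -> left_regular u -> exists v, mutually_inverse u v.
Proof.
move=> art ureg.
have uXreg k x : x * u ^+ k = 0 -> x = 0.
  elim: k => [|k IH]; first by rewrite expr0 mulr1.
  by rewrite exprSr mulrA => /ureg/IH.
have [|k|m /(_ _ (leqnSn m))] :=
  art (fun k => [set x | exists a, a * u ^+ k = x]).
- move=> k; split.
  + by exists 0; rewrite mul0r.
  + by move=> _ _ [a <-] [b <-]; exists (a + b); rewrite mulrDl.
  + by move=> c _ [a <-]; exists (c * a); rewrite mulrA.
- by move=> _ [a <-]; exists (a * u); rewrite -mulrA -exprS.
rewrite eqEsubset => -[_] /(_ (u ^+ m))[]; first by exists 1; rewrite mul1r.
move=> q; rewrite exprS mulrA => e.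
have qu : q * u = 1.
  apply/eqP; rewrite -subr_eq0; apply/eqP/(uXreg m).
  by rewrite mulrBl mul1r e subrr.
exists q; split=> //; apply/eqP; rewrite -subr_eq0; apply/eqP/ureg.
by rewrite mulrBl mul1r -mulrA qu mulr1 subrr.
Qed.

End LeftIdeals.

(** * Transfer along surjections *)

Section Surjections.

(** The map [f] is a bare function so that the same lemma applies to it between
    the converse rings, where it settles right ideals. *)
Lemma left_artinian_surj (A B : pzRingType) (f : A -> B) :
  f 0 = 0 -> {morph f : x y / x + y} -> {morph f : x y / x * y} ->
  (forall y, exists x, f x = y) -> left_artinian A -> left_artinian B.
Proof.
move=> f0 fD fM fsurj art I_ Il Idec.
have [k|k x|m mP] := art (fun k => f @^-1` I_ k).
- have [I0 ID IM] := Il k; split=> [|x y Ix Iy|a x Ix].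
  + by rewrite /preimage /= f0.
  + by rewrite /preimage /= fD; apply: ID.
  + by rewrite /preimage /= fM; apply: IM.
- exact: Idec.
exists m => k mk; apply/seteqP; split=> y; have [x <-] := fsurj y => Ix.
  by have : (f @^-1` I_ m) x by rewrite -(mP k mk).
by have : (f @^-1` I_ k) x by rewrite (mP k mk).
Qed.

Lemma artinian_surj (A B : pzRingType) (f : {rmorphism A -> B}) :
  (forall y, exists x, f x = y) -> artinian A -> artinian B.
Proof.
move=> fsurj [lA rA]; split.
  exact: left_artinian_surj (rmorph0 f) (rmorphD f) (rmorphM f) fsurj lA.
exact: (@left_artinian_surj A^c B^c f) (rmorph0 f) (rmorphD f)
  (fun x y => rmorphM f y x) fsurj rA.
Qed.

Lemma two_sided_ideal_preimage (A B : pzRingType) (f : {rmorphism A -> B}) K :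
  two_sided_ideal K -> two_sided_ideal (f @^-1` K).
Proof.
move=> [[K0 KD KL] [_ _ KR]].
have pre0 : (f @^-1` K) 0 by rewrite /preimage /= rmorph0.
have preD x y : (f @^-1` K) x -> (f @^-1` K) y -> (f @^-1` K) (x + y).
  by rewrite /preimage /= rmorphD; apply: KD.
by split; split=> // a x; rewrite /preimage /= rmorphM; [apply: KL|apply: KR].
Qed.

Lemma maximal_left_ideal_preimage (A B : pzRingType)
    (f : {rmorphism A -> B}) I :
  (forall y, exists x, f x = y) ->
  maximal_left_ideal I -> maximal_left_ideal (f @^-1` I).
Proof.
move=> fsurj [lI nI Imax]; have [I0 ID IM] := lI; split.
- split.
  + by rewrite /preimage /= rmorph0.
  + by move=> x y; rewrite /preimage /= rmorphD; apply: ID.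
  + by move=> a x; rewrite /preimage /= rmorphM; apply: IM.
- move=> pT; apply: nI; apply: left_ideal_setT => //.
  by rewrite -(rmorph1 f); have : (f @^-1` I) 1 by rewrite pT.
- move=> J lJ IJ; have [J0 JD JM] := lJ.
  have lfJ : left_ideal (f @` J).
    split.
    + by exists 0; rewrite ?rmorph0.
    + move=> _ _ [x Jx <-] [y Jy <-]; exists (x + y); rewrite ?rmorphD //.
      exact: JD.
    + move=> a _ [x Jx <-]; have [b <-] := fsurj a.
      by exists (b * x); rewrite ?rmorphM //; apply: JM.
  have IfJ : I `<=` f @` J.
    by move=> y; have [x <-] := fsurj y => Ix; exists x => //; apply: IJ.
  have [e|e] := Imax _ lfJ IfJ; [left|right]; apply/seteqP; split=> // x Hx.
    by rewrite /preimage /= -e; exists x.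
  have [y Jy yx] : (f @` J) (f x) by rewrite e.
  rewrite -[x](subrK y); apply: JD => //; apply: IJ.
  by rewrite /preimage /= rmorphB yx subrr.
Qed.

End Surjections.

(** * Finite products of rings *)

Section ProductRing.
Variables (I : finType) (Q : I -> pzRingType).

Definition prod_ring := forall i, Q i.

HB.instance Definition _ := gen_eqMixin prod_ring.
HB.instance Definition _ := gen_choiceMixin prod_ring.

Implicit Types x y z : prod_ring.

Let add x y : prod_ring := fun i => x i + y i.
Let opp x : prod_ring := fun i => - x i.
Let zero : prod_ring := fun=> 0.
Let mul x y : prod_ring := fun i => x i * y i.
Let one : prod_ring := fun=> 1.

Fact prod_ring_addA : associative add.
Proof.
by move=> x y z; apply: functional_extensionality_dep => i; apply: addrA.
Qed.
Fact prod_ring_addC : commutative add.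
Proof.
by move=> x y; apply: functional_extensionality_dep => i; apply: addrC.
Qed.
Fact prod_ring_add0 : left_id zero add.
Proof.
by move=> x; apply: functional_extensionality_dep => i; apply: add0r.
Qed.
Fact prod_ring_addN : left_inverse zero opp add.
Proof.
by move=> x; apply: functional_extensionality_dep => i; apply: addNr.
Qed.
HB.instance Definition _ := GRing.isZmodule.Build prod_ring
  prod_ring_addA prod_ring_addC prod_ring_add0 prod_ring_addN.

Fact prod_ring_mulA : associative mul.
Proof.
by move=> x y z; apply: functional_extensionality_dep => i; apply: mulrA.
Qed.
Fact prod_ring_mul1 : left_id one mul.
Proof.
by move=> x; apply: functional_extensionality_dep => i; apply: mul1r.
Qed.
Fact prod_ring_mulr1 : right_id one mul.
Proof.
by move=> x; apply: functional_extensionality_dep => i; apply: mulr1.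
Qed.
Fact prod_ring_mulDl : left_distributive mul add.
Proof.
by move=> x y z; apply: functional_extensionality_dep => i; apply: mulrDl.
Qed.
Fact prod_ring_mulDr : right_distributive mul add.
Proof.
by move=> x y z; apply: functional_extensionality_dep => i; apply: mulrDr.
Qed.
HB.instance Definition _ := GRing.Zmodule_isPzRing.Build prod_ring
  prod_ring_mulA prod_ring_mul1 prod_ring_mulr1 prod_ring_mulDl prod_ring_mulDr.

Definition prod_ring_proj i (x : prod_ring) : Q i := x i.

Fact prod_ring_proj_zmod i : zmod_morphism (@prod_ring_proj i).
Proof. by []. Qed.
Fact prod_ring_proj_monoid i : monoid_morphism (@prod_ring_proj i).
Proof. by []. Qed.
HB.instance Definition _ i := GRing.isZmodMorphism.Build prod_ring (Q i)
  (@prod_ring_proj i) (@prod_ring_proj_zmod i).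
HB.instance Definition _ i := GRing.isMonoidMorphism.Build prod_ring (Q i)
  (@prod_ring_proj i) (@prod_ring_proj_monoid i).

Definition prod_ring_single i (a : Q i) : prod_ring := dfwith (0 : prod_ring) a.

Lemma prod_ring_proj_surj i (a : Q i) : exists x, prod_ring_proj i x = a.
Proof. by exists (prod_ring_single a); apply: dfwith_in. Qed.

Lemma prod_ring_glue x (y : I -> prod_ring) :
  (forall i, y i i = x i) -> x = \sum_i prod_ring_single (1 : Q i) * y i.
Proof.
move=> xy; apply: functional_extensionality_dep => j.
rewrite -[RHS]/(prod_ring_proj j _) rmorph_sum (bigD1 j) //= big1 ?addr0.
  by rewrite rmorphM /= /prod_ring_proj /prod_ring_single dfwith_in mul1r.
move=> i ij; rewrite rmorphM /= /prod_ring_proj /prod_ring_single.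
by rewrite dfwith_out ?mul0r.
Qed.

(** A left ideal of the product is determined by its projections, because it
    absorbs the central idempotents of the factors. *)
Lemma left_artinian_prod_ring :
  (forall i, left_artinian (Q i)) -> left_artinian prod_ring.
Proof.
move=> art I_ Il Idec.
have Ile k m : (k <= m)%N -> I_ m `<=` I_ k.
  elim: m => [|m IH]; first by rewrite leqn0 => /eqP->.
  rewrite leq_eqVlt => /predU1P[->//|/IH mk]; exact: subset_trans mk.
have stab i : exists m, forall k, (m <= k)%N ->
    prod_ring_proj i @` I_ k = prod_ring_proj i @` I_ m.
  apply: (art i (fun k => prod_ring_proj i @` I_ k)) => k; last first.
    by move=> _ [x Ix <-]; exists x => //; apply: Idec.
  have [I0 ID IM] := Il k; split.
  - by exists 0.
  - by move=> _ _ [x Ix <-] [y Iy <-]; exists (x + y) => //; apply: ID.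
  - move=> a _ [x Ix <-]; have [b <-] := prod_ring_proj_surj a.
    by exists (b * x) => //; apply: IM.
have [m mP] := choice stab.
pose M := \max_i m i; exists M => k Mk; apply/seteqP; split; first exact: Ile.
move=> x Ix.
have lift i : exists y, I_ k y /\ y i = x i.
  have mM : (m i <= M)%N by apply: leq_bigmax.
  have [y Iy yx] : (prod_ring_proj i @` I_ k) (x i).
    by rewrite (mP i k (leq_trans mM Mk)) -(mP i M mM); exists x.
  by exists y.
have [y yP] := choice lift.
rewrite (@prod_ring_glue x y) => [|i]; last by have [] := yP i.
apply: left_ideal_sum => // i; have [_ _ IM] := Il k.
by apply: IM; have [] := yP i.
Qed.

End ProductRing.

Lemma artinian_prod_ring (I : finType) (Q : I -> pzRingType) :
  (forall i, artinian (Q i)) -> artinian (prod_ring Q).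
Proof.
move=> art; split; first by apply: left_artinian_prod_ring => i; case: (art i).
(* The converse of the product is convertible to the product of converses. *)
exact: (@left_artinian_prod_ring I (fun i => (Q i)^c)
  (fun i => let: conj _ rart := art i in rart)).
Qed.

(** * Two-sided ideals of semisimple Artinian rings *)

Section SemisimpleRings.
Variable Q : pzRingType.
Implicit Types (I J K L M : set Q) (x y : Q).

Definition maximal_two_sided_ideal M : Prop :=
  [/\ two_sided_ideal M, ~ M 1
    & forall K, two_sided_ideal K -> M `<=` K -> K `<=` M \/ K 1].

Lemma simple_ringP K : simple_ring Q -> two_sided_ideal K ->
  (exists2 x, K x & x <> 0) -> K 1.
Proof.
move=> [_ simple] /simple[->|->//] [x /= ->].
by case.
Qed.

(** Let [L] be a minimal nonzero left ideal.  The two-sided ideal annihilating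
    [L] from the left does not contain 1, hence is 0, so [x l <> 0] for some [l]
    in [L]; the annihilator of such an [l] is then a maximal left ideal. *)
Lemma simple_artinian_separated x : simple_artinian Q -> x <> 0 ->
  exists I, maximal_left_ideal I /\ ~ I x.
Proof.
move=> [[art _] simple] x0.
have [L [[lL [l0 Ll0 l0n]] Lmin]] : exists L,
    (left_ideal L /\ exists2 l, L l & l <> 0) /\
    forall J, left_ideal J /\ (exists2 l, J l & l <> 0) -> J `<=` L -> L `<=` J.
  apply: left_artinian_minimal art _ _ => [I []//|].
  by exists setT; split=> //; exists 1 => //; case: simple.
have [_ LD LM] := lL.
pose A := [set y | forall l, L l -> y * l = 0].
have tA : two_sided_ideal A.
  have A0 : A 0 by move=> l _; rewrite mul0r.
  have AD y z : A y -> A z -> A (y + z).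
    by move=> Ay Az l Ll; rewrite mulrDl Ay // Az // addr0.
  split; split=> // a y Ay l Ll; rewrite -mulrA; last by apply/Ay/LM.
  by rewrite Ay ?mulr0.
have [l Ll xl] : exists2 l, L l & x * l <> 0.
  apply: contrapT => nl; apply: l0n.
  have : A 1.
    apply: simple_ringP => //; exists x => // l Ll.
    by apply: contrapT => xl; apply: nl; exists l.
  by move=> /(_ l0 Ll0); rewrite mul1r.
pose I := [set y | y * l = 0].
have lI : left_ideal I.
  split; rewrite /I /=; first by rewrite mul0r.
    by move=> y z yl zl; rewrite mulrDl yl zl addr0.
  by move=> a y yl; rewrite -mulrA yl mulr0.
exists I; split=> //; split=> //.
  by move=> IT; apply: xl; have : I x by rewrite IT.
move=> J lJ IJ; have [_ JD JM] := lJ.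
have [JI|] := pselect (J `<=` I); first by left; apply/seteqP.
move=> /existsNP[y /not_implyP[Jy yl]]; right; apply: left_ideal_setT => //.
pose Qyl := [set z | exists a, a * (y * l) = z].
have lQyl : left_ideal Qyl.
  split; first by exists 0; rewrite mul0r.
    by move=> _ _ [a <-] [b <-]; exists (a + b); rewrite mulrDl.
  by move=> c _ [a <-]; exists (c * a); rewrite -mulrA.
have [||a al] := Lmin Qyl _ _ l Ll.
- by split; [exact: lQyl|exists (y * l) => //; exists 1; rewrite mul1r].
- by move=> _ [a <-]; apply/LM/LM.
rewrite -[1](subrK (a * y)); apply: JD; last exact: JM.
by apply: IJ; rewrite /I /= mulrBl mul1r -mulrA al subrr.
Qed.

Hypothesis ss : semisimple_artinian Q.

Lemma semisimple_separated x :
  x <> 0 -> exists I, maximal_left_ideal I /\ ~ I x.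
Proof.
move=> x0; apply: contrapT => no; apply: x0.
have : @jacobson_radical Q x.
  by move=> I mI; apply: contrapT => nIx; apply: no; exists I.
by rewrite ss.2.
Qed.

(** A left ideal [L] minimal for [K + L = Q] meets [K] trivially: if [x <> 0]
    lies in both and [I] is a maximal left ideal that avoids [x], then the
    smaller [L `&` I] is still a supplement of [K]. *)
Lemma semisimple_complement K : left_ideal K ->
  exists L, [/\ left_ideal L, exists k l, [/\ K k, L l & k + l = 1]
    & forall x, K x -> L x -> x = 0].
Proof.
move=> lK; have [K0 KD KM] := lK.
have [L [[lL [k [l [Kk Ll kl]]]] Lmin]] : exists L,
    (left_ideal L /\ exists k l, [/\ K k, L l & k + l = 1]) /\
    forall J, left_ideal J /\ (exists k l, [/\ K k, J l & k + l = 1]) ->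
      J `<=` L -> L `<=` J.
  apply: left_artinian_minimal ss.1.1 _ _ => [I []//|].
  by exists setT; split=> //; exists 0, 1; split; rewrite ?add0r.
exists L; split=> // [|x Kx Lx]; first by exists k, l.
apply: contrapT => /semisimple_separated[I [mI nIx]]; apply: (nIx).
have [a [i [Ii ai]]] := maximal_left_ideal_unit_sum mI nIx.
have [lI _ _] := mI.
suff /(_ x Lx)[] : L `<=` L `&` I by [].
apply: Lmin; last by move=> ? [].
split; first exact: left_idealI.
have [_ _ LM] := lL; have [_ _ IM] := lI.
exists (k + l * (a * x)), (l * i); split.
- by apply: KD => //; apply/KM/KM.
- split; last exact: IM.
  have -> : l * i = l - l * (a * x).
    by rewrite -[i](addKr (a * x)) ai addrC mulrBr mulr1.
  by apply: left_idealB => //; apply/LM/LM.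
- by rewrite -addrA -mulrDr ai mulr1.
Qed.

(** A complement [L] of [K] splits [1 = e + f], and [e] is a right identity of
    [K].  The right ideal [(1 - e) K] has square zero, so every maximal left
    ideal contains it, whence it vanishes. *)
Lemma semisimple_ideal_identity K : two_sided_ideal K ->
  exists2 e, K e & forall k, K k -> e * k = k.
Proof.
move=> [lK [_ _ KR]].
have [L [[_ _ LM] [e [f [Ke Lf ef]]] KL0]] := semisimple_complement lK.
have kf0 k : K k -> k * f = 0.
  by move=> Kk; apply: KL0; [apply: KR|apply: LM].
exists e => // k Kk; apply/esym/eqP; rewrite -subr_eq0; apply/eqP.
have -> : k - e * k = f * k.
  by rewrite -[k in k - _]mul1r -ef mulrDl addrC addKr.
apply: contrapT => /semisimple_separated[I [mI nI]]; apply: (nI).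
have [a [i [Ii]]] := maximal_left_ideal_unit_sum mI nI.
move=> /(congr1 (fun z => f * k * z)).
rewrite mulr1 mulrDr [f * k * (a * _)]mulrA -[f * k * a]mulrA !mulrA.
have -> : f * k * a * f = 0.
  by rewrite -!mulrA [k * _]mulrA kf0 ?mulr0 //; apply: KR.
by rewrite mul0r add0r => <-; have [[_ _ IM] _ _] := mI; apply: IM.
Qed.

(** Such an [M] is the annihilator of a minimal nonzero two-sided ideal inside
    [K]. *)
Lemma semisimple_maximal_two_sided_ideal K x :
  two_sided_ideal K -> K x -> x <> 0 ->
  exists M, maximal_two_sided_ideal M /\ ~ (K `<=` M).
Proof.
move=> tK Kx x0.
have [N [[tN NK [y Ny y0]] Nmin]] : exists N,
    [/\ two_sided_ideal N, N `<=` K & exists2 y, N y & y <> 0] /\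
    forall J, [/\ two_sided_ideal J, J `<=` K & exists2 y, J y & y <> 0] ->
      J `<=` N -> N `<=` J.
  apply: left_artinian_minimal ss.1.1 _ _ => [I [[]]//|].
  by exists K; split=> //; exists x.
have [e Ne eN] := semisimple_ideal_identity tN.
have [[_ ND NM] [_ _ NR]] := tN.
have e0 : e <> 0 by move=> e0; apply: y0; rewrite -(eN y Ny) e0 mul0r.
pose M := [set z | z * e = 0].
exists M; split; last first.
  by move=> /(_ e (NK e Ne)); rewrite /M /= eN.
have M0 : M 0 by rewrite /M /= mul0r.
have MD u v : M u -> M v -> M (u + v).
  by rewrite /M /= => ue ve; rewrite mulrDl ue ve addr0.
have tM : two_sided_ideal M.
  split; split=> // a u; rewrite /M /= => ue; first by rewrite -mulrA ue mulr0.
  by rewrite -mulrA -(eN (a * e)) ?mulrA ?ue ?mul0r //; apply: NM.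
split=> //; first by rewrite /M /= mul1r.
move=> J tJ MJ; have [JM|] := pselect (J `<=` M); first by left.
move=> /existsNP[u /not_implyP[Ju ue]]; right.
have [[_ JD _] [_ _ JR]] := tJ.
have NJ : N `<=` N `&` J.
  apply: Nmin => [|z []//]; split; first exact: two_sided_idealI.
    by move=> z [/NK].
  by exists (u * e) => //; split; [apply: NM|apply: JR].
rewrite -[1](subrK e); apply: JD; last by have [] := NJ e Ne.
by apply: MJ; rewrite /M /= mulrBl mul1r eN // subrr.
Qed.

(** An intersection of finitely many maximal ideals that is minimal among such
    intersections is 0, since a nonzero one could still be cut down. *)
Lemma semisimple_finite_maximal_ideals : exists (I : finType) (M : I -> set Q),
  (forall i, maximal_two_sided_ideal (M i)) /\
  forall x, (forall i, M i x) -> x = 0.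
Proof.
have tcap (I : finType) (M : I -> set Q) :
    (forall i, maximal_two_sided_ideal (M i)) ->
    two_sided_ideal (\bigcap_i M i).
  by move=> mM; apply: two_sided_ideal_bigcap => i; case: (mM i).
have [K [[I [M [mM KM]]] Kmin]] : exists K,
    (exists (I : finType) (M : I -> set Q),
      (forall i, maximal_two_sided_ideal (M i)) /\ K = \bigcap_i M i) /\
    forall J, (exists (I : finType) (M : I -> set Q),
      (forall i, maximal_two_sided_ideal (M i)) /\ J = \bigcap_i M i) ->
      J `<=` K -> K `<=` J.
  apply: left_artinian_minimal ss.1.1 _ _.
    by move=> _ [I [M [/tcap[lM _] ->]]].
  (* The empty intersection is the whole ring. *)
  by exists (\bigcap_(i : void) set0), void, (fun=> set0); split=> // -[].
exists I, M; split=> // x Mx; apply: contrapT => x0.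
have tK : two_sided_ideal K by rewrite KM; apply: tcap.
have Kx : K x by rewrite KM.
have [M' [mM' KM']] := semisimple_maximal_two_sided_ideal tK Kx x0; apply: KM'.
suff KKM' : K `<=` K `&` M' by move=> z /KKM'[].
apply: Kmin => [|z []//].
(* One more index adjoins M' to the family. *)
exists (option I), (fun o => if o is Some i then M i else M'); split.
  by case.
rewrite KM; apply/seteqP; split=> z.
  by move=> [Mz M'z] [i|] _ //; apply: Mz.
move=> Mz; split; last exact: (Mz None).
by move=> i _; apply: (Mz (Some i)).
Qed.

End SemisimpleRings.

Lemma artinian_quotient (Q : pzRingType) (M : set Q) (hM : two_sided_ideal M) :
  artinian Q -> artinian (quotient_ring hM).
Proof. exact/artinian_surj/quotient_pi_surj. Qed.

(** Ideals of the quotient are ideals of [Q] above [M]. *)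
Lemma simple_quotient (Q : pzRingType) (M : set Q) (hM : two_sided_ideal M) :
  maximal_two_sided_ideal M -> simple_ring (quotient_ring hM).
Proof.
move=> [_ M1 Mmax]; split.
  rewrite -(rmorph1 (quotient_pi hM)) -(rmorph0 (quotient_pi hM)).
  by move=> /quotient_piP; rewrite subr0.
move=> K tK; have [[K0 _ _] _] := tK.
have tK' := two_sided_ideal_preimage (quotient_pi hM) tK.
case: (Mmax _ tK').
- move=> m Mm; rewrite /preimage /=; suff -> : quotient_pi hM m = 0 by [].
  by rewrite -(rmorph0 (quotient_pi hM)); apply/quotient_piP; rewrite subr0.
- move=> KM; left; apply/seteqP; split=> [q|q ->//].
  have [x <-] := quotient_pi_surj q => Kx.
  rewrite /= -(rmorph0 (quotient_pi hM)).
  by apply/quotient_piP; rewrite subr0; apply: KM.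
- rewrite /preimage /= rmorph1 => K1; right; apply: left_ideal_setT => //.
  by case: tK.
Qed.

(** A maximal left ideal of a factor pulls back to the product, so nonzero
    elements of the product are still avoided by maximal left ideals. *)
Lemma semisimple_prod_ring (I : finType) (Q : I -> pzRingType) :
  (forall i, simple_artinian (Q i)) -> semisimple_artinian (prod_ring Q).
Proof.
move=> sQ; split; first by apply: artinian_prod_ring => i; case: (sQ i).
apply/seteqP; split=> [x Jx|x -> I' [[]]//].
apply: functional_extensionality_dep => i; apply: contrapT => xi.
have [J [mJ nJ]] := simple_artinian_separated (sQ i) xi.
apply: nJ; apply: (Jx (prod_ring_proj i @^-1` J)).
exact/maximal_left_ideal_preimage/mJ/prod_ring_proj_surj.
Qed.

(** * Rings of left fractions *)

Definition is_unit (Q : pzRingType) (u : Q) : Prop :=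
  exists v, mutually_inverse u v.

Lemma is_unitM (Q : pzRingType) (u v : Q) :
  is_unit u -> is_unit v -> is_unit (u * v).
Proof.
move=> [u' uP] [v' vP]; exists (v' * u'); split.
  by rewrite -mulrA (mulrA _ v') vP.1 mul1r uP.1.
by rewrite -mulrA (mulrA u') uP.2 mul1r vP.2.
Qed.

Lemma is_unit_rmorph (A B : pzRingType) (f : {rmorphism A -> B}) u :
  is_unit u -> is_unit (f u).
Proof.
move=> [v [uv vu]].
by exists (f v); split; rewrite -rmorphM ?uv ?vu rmorph1.
Qed.

Section Fractions.
Variables (R Q : pzRingType) (f : {rmorphism R -> Q}).
Implicit Types (S B : set R) (r s t : R) (q u v : Q).

Lemma left_localization_fraction S q : is_left_localization S f ->
  exists s r, [/\ S s, is_unit (f s) & f s * q = f r].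
Proof.
move=> [_ frac _]; have [s [r [v [Ss fsv ->]]]] := frac q.
exists s, r; split=> //; first by exists v.
by rewrite mulrA fsv.1 mul1r.
Qed.

(** The Ore condition holds because a right fraction [f r / f s] is also a left
    fraction; both the Ore equation and reversibility are then read off in [Q]
    and pulled back to [R] through [ker f = ass S]. *)
Lemma left_localization_of_fractions S :
  multiplicative_set S -> (forall s, S s -> is_unit (f s)) ->
  (forall q, exists s r, S s /\ f s * q = f r) ->
  (forall r, f r = 0 <-> ass S r) ->
  left_denominator_set S /\ is_left_localization S f.
Proof.
move=> mS unitS frac ker; have [S1 SM S0] := mS; split; last first.
  split=> // q; have [s [r [Ss e]]] := frac q.
  have [v vP] := unitS s Ss; exists s, r, v; split=> //.
  by rewrite -e mulrA vP.2 mul1r.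
split; last first.
  move=> r s Ss rs0; apply/ker; have [v vP] := unitS s Ss.
  by rewrite -[f r]mulr1 -vP.1 mulrA -rmorphM rs0 rmorph0 mul0r.
split=> // r s Ss; have [v vP] := unitS s Ss.
have [s1 [r1 [Ss1 e]]] := frac (f r * v).
have [t St /eqP] : ass S (s1 * r - r1 * s).
  by apply/ker; rewrite rmorphB !rmorphM -e -!mulrA vP.2 mulr1 subrr.
rewrite mulrBr subr_eq0 !mulrA => /eqP ts.
exists (t * s1 * r); split; last by exists (t * r1).
by exists (t * s1) => //; apply: SM.
Qed.

(** With [Q] left artinian it suffices that [f c] be left regular, and this can
    be tested on numerators. *)
Lemma regular_image_unit c :
  left_artinian Q ->
  (forall q, exists s r, is_unit (f s) /\ f s * q = f r) ->
  (forall r, f (r * c) = 0 -> f r = 0) -> is_unit (f c).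
Proof.
move=> art frac creg; apply: left_artinian_left_regular_unit => // q qc.
have [s [r [[v vP] e]]] := frac q.
rewrite -[q]mul1r -vP.2 -mulrA e creg ?mulr0 //.
by rewrite rmorphM -e -mulrA qc mulr0.
Qed.

Lemma kernel_two_sided_ideal (K : set R) :
  (forall r, f r = 0 <-> K r) -> two_sided_ideal K.
Proof.
move=> ker; suff -> : K = f @^-1` [set 0].
  apply: two_sided_ideal_preimage.
  by split; split=> //= [x y -> ->|b x ->]; rewrite ?addr0 ?mulr0 ?mul0r.
by apply/seteqP; split=> r /ker.
Qed.

Lemma quotient_pi_eq0 (K : set R) (hK : two_sided_ideal K) :
  (forall r, f r = 0 <-> K r) -> forall r, quotient_pi hK r = 0 <-> f r = 0.
Proof.
by move=> ker r; rewrite -(rmorph0 (quotient_pi hK)) quotient_piP subr0 ker.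
Qed.

Lemma unit_image_regular (K : set R) (hK : two_sided_ideal K) t :
  (forall r, f r = 0 <-> K r) -> is_unit (f t) -> regular (quotient_pi hK t).
Proof.
move=> /(quotient_pi_eq0 hK) pi0 [v [tv vt]].
split=> x; have [r <-] := quotient_pi_surj x; rewrite -rmorphM.
  by move=> /pi0 e; apply/pi0; rewrite -[f r]mulr1 -tv mulrA -rmorphM e mul0r.
by move=> /pi0 e; apply/pi0; rewrite -[f r]mul1r -vt -mulrA -rmorphM e mulr0.
Qed.

(** The preimage of the units is the largest set at which [f] can be a
    localization; that it is one only needs enough fractions and enough
    annihilators of the kernel. *)
Lemma left_localization_unit_preimage :
  (1 : Q) <> 0 ->
  (forall q, exists s r, is_unit (f s) /\ f s * q = f r) ->
  (forall r, f r = 0 -> exists2 s, is_unit (f s) & s * r = 0) ->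
  let S := f @^-1` (@is_unit Q) in
  left_denominator_set S /\ is_left_localization S f.
Proof.
move=> Q1 frac ker S; apply: left_localization_of_fractions => //.
  split=> [|s t us ut|[v]]; rewrite /S /preimage /=.
  - by rewrite rmorph1; exists 1; split; rewrite mulr1.
  - by rewrite rmorphM; apply: is_unitM.
  - by rewrite rmorph0 => -[/esym]; rewrite mul0r.
move=> r; split=> [/ker //|[s [v vP] sr]].
by rewrite -[f r]mul1r -vP.2 -mulrA -rmorphM sr rmorph0 mulr0.
Qed.

(** The left fractions with numerators in [B] form a left ideal [L] of [Q].  For
    [s] in [S] the left ideals [L (f s)^k] decrease, so they stabilize and [L]
    is closed under right multiplication by [(f s)^-1].  Thus [L] is a nonzero
    two-sided ideal, so it contains 1, and 1 is a fraction with numerator in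
    [B]. *)
Lemma simple_localization_ideal_meets S B b :
  left_ore S -> is_left_localization S f -> simple_artinian Q ->
  two_sided_ideal B -> B b -> f b <> 0 ->
  exists b' s, [/\ B b', S s & f b' = f s].
Proof.
move=> ore loc [[art _] simple] [[B0 BD BL] [_ _ BR]] Bb fb0.
have [[S1 SM _] _] := ore; have [unitS frac _] := loc.
pose L := [set q | exists s b, [/\ S s, B b & f s * q = f b]].
have lL : left_ideal L.
  split.
  - by exists 1, 0; rewrite rmorph0 mulr0.
  - move=> q q' [s [c [Ss Bc e]]] [s' [c' [Ss' Bc' e']]].
    have [s1 [r1 [Ss1 sr]]] := left_ore_pair s ore Ss'.
    exists (s1 * s), (s1 * c + r1 * c'); split; first exact: SM.
      by apply: BD; apply: BL.
    by rewrite mulrDr {2}sr rmorphD !rmorphM -!mulrA e e'.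
  - move=> a q [s [c [Ss Bc e]]]; have [t [r [v [St tv ->]]]] := frac a.
    have [s1 [r1 [Ss1 sr]]] := left_ore_pair r ore Ss.
    exists (s1 * t), (r1 * c); split; [exact: SM|exact: BL|].
    rewrite rmorphM -!mulrA [f t * _]mulrA tv.1 mul1r mulrA.
    by rewrite -rmorphM sr !rmorphM -mulrA e.
have LR q r : L q -> L (q * f r).
  move=> [s [c [Ss Bc e]]]; exists s, (c * r); split=> //; first exact: BR.
  by rewrite mulrA e rmorphM.
have LV q s v : S s -> mutually_inverse (f s) v -> L q -> L (q * v).
  move=> Ss [sv vs]; have [_ LD LM] := lL.
  have svX k : f s ^+ k * v ^+ k = 1.
    by rewrite -exprMn_comm ?sv ?expr1n // /GRing.comm sv vs.
  (* [set q | L (q * v ^+ k)] is L (f s)^k. *)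
  have [k|k q'|m /(_ _ (leqnSn m)) e Lq] :=
    art (fun k => [set q | L (q * v ^+ k)]).
  - split; rewrite /= ?mul0r; first by case: lL.
      by move=> x y; rewrite mulrDl; apply: LD.
    by move=> a x; rewrite -mulrA; apply: LM.
  - by rewrite /= => /(LR _ s); rewrite exprSr mulrA -mulrA vs mulr1.
  have : [set q | L (q * v ^+ m)] (q * f s ^+ m) by rewrite /= -mulrA svX mulr1.
  by rewrite -e /= exprSr mulrA -(mulrA q) svX mulr1.
have tL : two_sided_ideal L.
  split=> //; have [L0 LD _] := lL; split=> // a q Lq.
  have [s [r [v [Ss sv ->]]]] := frac a.
  by rewrite mulrA; apply/LR/(LV _ _ _ Ss sv).
have [|s [c [Ss Bc e]]] := simple_ringP simple tL.
- by exists (f b) => //; exists 1, b; rewrite rmorph1 mul1r.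
by exists c, s; split=> //; rewrite -e mulr1.
Qed.

End Fractions.

(** * Gluing fractions over simple localizations *)

Section ProductMorphism.
Variables (R : pzRingType) (I : finType) (Q : I -> pzRingType).
Variable f : forall i, {rmorphism R -> Q i}.

Definition prod_ring_map (r : R) : prod_ring Q := fun i => f i r.

Fact prod_ring_map_zmod : zmod_morphism prod_ring_map.
Proof.
by move=> x y; apply: functional_extensionality_dep => i; apply: rmorphB.
Qed.
Fact prod_ring_map_monoid : monoid_morphism prod_ring_map.
Proof.
split=> [|x y]; apply: functional_extensionality_dep => i; first exact: rmorph1.
exact: rmorphM.
Qed.
HB.instance Definition _ := GRing.isZmodMorphism.Build R (prod_ring Q)
  prod_ring_map prod_ring_map_zmod.
HB.instance Definition _ := GRing.isMonoidMorphism.Build R (prod_ring Q)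
  prod_ring_map prod_ring_map_monoid.

Lemma prod_ring_map_eq0 r : prod_ring_map r = 0 <-> forall i, f i r = 0.
Proof.
split=> [r0 i|r0]; first by rewrite -[f i r]/(prod_ring_map r i) r0.
by apply: functional_extensionality_dep => i; apply: r0.
Qed.

Lemma prod_ring_unit (x : prod_ring Q) :
  (forall i, is_unit (x i)) -> is_unit x.
Proof.
move=> ux; pose v : prod_ring Q := fun i => sval (cid (ux i)).
by exists v; split; apply: functional_extensionality_dep => i;
  have [] := svalP (cid (ux i)).
Qed.

Variable S : I -> set R.
Hypotheses (den : forall i, left_denominator_set (S i))
  (loc : forall i, is_left_localization (S i) (f i))
  (simple : forall i, simple_artinian (Q i))
  (irredundant :
    forall i, exists r, (forall j, j != i -> f j r = 0) /\ f i r <> 0).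

(** Irredundance yields [b_i] in [R] that is 0 in every factor but the [i]-th
    and invertible there.  If [q_i = (f_i s_i)^-1 (f_i r_i)], then
    [\sum_i b_i s_i] is a common denominator for the tuple [q], with numerator
    [\sum_i b_i r_i]. *)
Lemma prod_ring_map_fraction (q : prod_ring Q) :
  exists s r,
    is_unit (prod_ring_map s) /\ prod_ring_map s * q = prod_ring_map r.
Proof.
have idem i : exists b, (forall j, j != i -> f j b = 0) /\ is_unit (f i b).
  have [r [r0 fr0]] := irredundant i.
  have [||b [s [b0 Ss e]]] := @simple_localization_ideal_meets _ _ _ _
      [set b | forall j, j != i -> f j b = 0] r
      (den i).1 (loc i) (simple i) _ _ fr0.
  - split; split=> /= [j ij|x y x0 y0 j ij|a x x0 j ij];
      by rewrite ?(rmorph0, rmorphD, rmorphM) // ?x0 ?y0 ?addr0 ?mulr0 ?mul0r.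
  - exact: r0.
  by exists b; split=> //; rewrite e; have [inv _ _] := loc i; apply: inv.
have frac i : exists sr : R * R,
    is_unit (f i sr.1) /\ f i sr.1 * q i = f i sr.2.
  have [s [r [_ us e]]] := left_localization_fraction (q i) (loc i).
  by exists (s, r).
have [b bP] := choice idem; have [sr srP] := choice frac.
have fb i (F : I -> R) : f i (\sum_j b j * F j) = f i (b i) * f i (F i).
  rewrite rmorph_sum (bigD1 i) //= big1 ?addr0 ?rmorphM // => j ji.
  by rewrite rmorphM (bP j).1 ?mul0r // eq_sym.
exists (\sum_j b j * (sr j).1), (\sum_j b j * (sr j).2); split.
  apply: prod_ring_unit => i; rewrite /prod_ring_map fb.
  by apply: is_unitM; [case: (bP i)|case: (srP i)].
apply: functional_extensionality_dep => i.
rewrite -[LHS]/(prod_ring_map _ i * q i) /prod_ring_map !fb.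
by rewrite -mulrA (srP i).2.
Qed.

End ProductMorphism.

(** * Localization at the left regular elements *)

Section LeftRegularLocalization.
Variable R : pzRingType.
Let C := @left_regular R.
Let a := ass C.

Lemma left_regularM s t : C s -> C t -> C (s * t).
Proof. by move=> Cs Ct x; rewrite mulrA => /Ct/Cs. Qed.

Lemma left_regular1 : C 1.
Proof. by move=> x; rewrite mulr1. Qed.

(** Each [S i] is the set of elements of [R] invertible modulo the maximal
    two-sided ideal [M i] of [C^-1 R]. *)
Lemma semisimple_localization_simple_localizations :
  left_localization_satisfies C semisimple_artinian ->
  exists (n : nat) (S : 'I_n -> set R),
    [/\ (0 < n)%N,
        forall i, left_localization_satisfies (S i) simple_artinian,
        a = \bigcap_(i in [set: 'I_n]) ass (S i)
      & exists ha : two_sided_ideal a,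
          dense [set quotient_pi ha c | c in C]
                (@regular (quotient_ring ha))].
Proof.
move=> [[[[_ _ C0] _] _] [Q [f [loc ss]]]]; have [unitC _ ker] := loc.
have frac q : exists s r, is_unit (f s) /\ f s * q = f r.
  by have [s [r [_ us e]]] := left_localization_fraction q loc; exists s, r.
have Q1 : (1 : Q) <> 0.
  rewrite -(rmorph1 f) => /ker[s Cs]; rewrite mulr1 => s0.
  by apply: C0; rewrite -s0.
have [I [M [mM M0]]] := semisimple_finite_maximal_ideals ss.
have tM i : two_sided_ideal (M i) by case: (mM i).
pose g i : {rmorphism R -> quotient_ring (tM i)} := quotient_pi (tM i) \o f.
have g0 i r : g i r = 0 <-> M i (f r).
  by rewrite -(rmorph0 (quotient_pi (tM i))) quotient_piP subr0.
pose S i := g i @^-1` (@is_unit _).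
have SP i : left_denominator_set (S i) /\ is_left_localization (S i) (g i).
  apply: left_localization_unit_preimage.
  - by have [_ M1 _] := mM i; rewrite -(rmorph1 (g i)) => /g0; rewrite rmorph1.
  - move=> q'; have [q <-] := quotient_pi_surj q'.
    have [s [r [us e]]] := frac q; exists s, r.
    split; first exact: (is_unit_rmorph (quotient_pi (tM i))).
    by rewrite /= -rmorphM e.
  - move=> r /g0 Mr; have [e Me eM] := semisimple_ideal_identity ss (tM i).
    (* The image of the numerator t of 1 - e is 1 - e up to a unit of Q, so
       it is invertible modulo M i and kills M i. *)
    have [s [t [[v vP] fst]]] := frac (1 - e).
    have gst : g i s = g i t.
      apply/eqP; rewrite -subr_eq0 -rmorphB; apply/eqP/g0.
      rewrite rmorphB -fst mulrBr mulr1 opprB addrCA subrr addr0.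
      by have [[_ _ MM] _] := tM i; apply: MM.
    have /ker[c Cc ctr] : f (t * r) = 0.
      by rewrite rmorphM -fst -mulrA mulrBl mul1r eM // subrr mulr0.
    exists (c * t); last by rewrite -mulrA.
    rewrite /preimage /= -[X in is_unit X]/(g i _) rmorphM -gst.
    apply: is_unitM; apply: (is_unit_rmorph (quotient_pi (tM i))).
      exact: unitC.
    by exists v.
have tQ i : simple_artinian (quotient_ring (tM i)).
  split; first by apply: artinian_quotient; case: ss.
  exact: simple_quotient.
have aE : a = \bigcap_(i in [set: 'I_#|I|]) ass (S (enum_val i)).
  apply/seteqP; split=> r.
    move=> /ker fr i _; have [_ [_ _ kg]] := SP (enum_val i); apply/kg.
    by rewrite /= fr rmorph0.
  move=> Sr; apply/ker/M0 => i; apply/g0; have [_ [_ _ kg]] := SP i; apply/kg.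
  by rewrite -(enum_rankK i); apply: Sr.
exists #|I|, (fun i => S (enum_val i)); split.
- rewrite lt0n; apply/eqP => I0; apply: Q1; apply: M0 => i.
  by have := fintype0 i; rewrite I0.
- move=> i; have [den gloc] := SP (enum_val i); split=> //.
  by exists (quotient_ring (tM (enum_val i))), (g (enum_val i)).
- exact: aE.
have ha : two_sided_ideal a := kernel_two_sided_ideal ker.
have pi0 := quotient_pi_eq0 ha ker.
have regC c : C c -> regular (quotient_pi ha c).
  by move=> /unitC; apply: unit_image_regular.
have q1 : (1 : quotient_ring ha) <> 0.
  by rewrite -(rmorph1 (quotient_pi ha)) => /pi0; rewrite rmorph1.
exists ha; split.
- split.
  + by exists 1; [exact: left_regular1|rewrite rmorph1].
  + move=> _ _ [s Cs <-] [t Ct <-]; exists (s * t); last by rewrite rmorphM.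
    exact: left_regularM.
  + by move=> [c /regC[cr _] c0]; apply: q1; apply: cr; rewrite c0 mulr0.
- split.
  + by split=> x; rewrite ?mulr1 ?mul1r.
  + move=> s t [sl sr] [tl tr]; split=> x; first by rewrite mulrA => /tl/sl.
    by rewrite -mulrA => /sr/tr.
  + by move=> [l0 _]; apply: q1; apply: l0; rewrite mulr0.
- by move=> _ [c /regC ? <-].
move=> t'; have [t <-] := quotient_pi_surj t' => -[tl _].
have [|v [tv vt]] := @regular_image_unit _ _ f t ss.1.1 frac.
  move=> r /pi0; rewrite rmorphM => /tl r0.
  by apply/pi0.
have [s [r [Cs us e]]] := left_localization_fraction v loc.
exists (quotient_pi ha r), s => //; rewrite -rmorphM; apply/quotient_piP/ker.
by rewrite rmorphB rmorphM -e -mulrA vt mulr1 subrr.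
Qed.

(** The localization is the product of the [(S i)^-1 R] over a minimal set of
    indices whose kernels still intersect in [a]: for redundant indices the
    product would be too large to consist of fractions. *)
Lemma simple_localizations_semisimple_localization (n : nat) (S : 'I_n -> set R)
    (ha : two_sided_ideal a) :
  (forall i, left_localization_satisfies (S i) simple_artinian) ->
  a = \bigcap_(i in [set: 'I_n]) ass (S i) ->
  dense [set quotient_pi ha c | c in C] (@regular (quotient_ring ha)) ->
  left_localization_satisfies C semisimple_artinian.
Proof.
move=> locS aE [[_ _ nC0] _ Creg Cdense].
pose P (A : {set 'I_n}) :=
  `[< forall r, (forall i, i \in A -> ass (S i) r) -> a r >].
have PT : P [set: 'I_n]%SET.
  by apply/asboolP => r Sr; rewrite aE => i _; apply: Sr; rewrite inE.
have [A /minsetP[/asboolP PA Amin] _] := minset_exists PT.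
(* By minimality of A, removing i enlarges the intersection beyond a. *)
have irr (i : 'I_n) : i \in A ->
    exists r, (forall j, j \in A -> j != i -> ass (S j) r) /\ ~ a r.
  move=> iA; apply: contrapT => nr.
  suff /Amin/(_ (finset.subsetDl _ _)) AE : P (A :\ i)%SET.
    by move: iA; rewrite -AE !inE eqxx.
  apply/asboolP => r Sr; apply: contrapT => ar; apply: nr; exists r; split=> //.
  by move=> j jA ji; apply: Sr; rewrite !inE ji.
pose I : finType := {i : 'I_n | i \in A}.
pose T i (Qf : {Q : pzRingType & {rmorphism R -> Q}}) :=
  is_left_localization (S i) (projT2 Qf) /\ simple_artinian (projT1 Qf).
have /choice[Qf QfP] : forall i : I, exists Qf, T (val i) Qf.
  by move=> i; have [_ [Q [f [? ?]]]] := locS (val i); exists (existT _ Q f).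
pose Q i := projT1 (Qf i); pose f i : {rmorphism R -> Q i} := projT2 (Qf i).
have loc i : is_left_localization (S (val i)) (f i) by case: (QfP i).
have sQ i : simple_artinian (Q i) by case: (QfP i).
have den (i : I) : left_denominator_set (S (val i)) by case: (locS (val i)).
pose F : {rmorphism R -> prod_ring Q} := prod_ring_map f.
have ker r : F r = 0 <-> a r.
  rewrite prod_ring_map_eq0; split=> [r0|ar i]; last first.
    by have [_ _ k] := loc i; apply/k; move: ar; rewrite aE; apply.
  apply: PA => i iA; have [_ _ k] := loc (exist _ i iA); apply/k; exact: r0.
have irrf i : exists r, (forall j, j != i -> f j r = 0) /\ f i r <> 0.
  have [r [Sr ar]] := irr _ (valP i); exists r.
  have fr j : j != i -> f j r = 0.
    by move=> ji; have [_ _ k] := loc j; apply/k/Sr; [exact: valP|].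
  split=> // fi0; apply: ar; apply/ker/prod_ring_map_eq0 => j.
  by have [->//|/fr] := eqVneq j i.
have frac := prod_ring_map_fraction den loc sQ irrf.
have ss := semisimple_prod_ring sQ.
have pi0 := quotient_pi_eq0 ha ker.
have unitC c : C c -> is_unit (F c).
  move=> Cc; apply: regular_image_unit ss.1.1 frac _ => r /pi0.
  have [cl _] : regular (quotient_pi ha c) by apply: Creg; exists c.
  by rewrite rmorphM => /cl/pi0.
have [den' loc'] : left_denominator_set C /\ is_left_localization C F.
  apply: left_localization_of_fractions => //.
    split; [exact: left_regular1|exact: left_regularM|].
    by move=> C0; apply: nC0; exists 0; rewrite ?rmorph0.
  move=> q; have [t [r [ut e]]] := frac q.
  (* Density trades the denominator t for a left multiple in C modulo a. *)
  have [r' [c Cc]] := Cdense _ (unit_image_regular ha ker ut).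
  have [y <-] := quotient_pi_surj r'; rewrite -rmorphM => /quotient_piP/ker.
  rewrite rmorphB => /eqP; rewrite subr_eq0 => /eqP cE.
  by exists c, (y * r); split=> //; rewrite cE !rmorphM -mulrA e.
by split=> //; exists (prod_ring Q), F.
Qed.

End LeftRegularLocalization.

Theorem theorem3p5 (R : pzRingType) :
  let C := @left_regular R in
  let a := ass C in
  left_localization_satisfies C semisimple_artinian <->
  exists (n : nat) (S : 'I_n -> set R),
    [/\ (0 < n)%N,
        forall i, left_localization_satisfies (S i) simple_artinian,
        a = \bigcap_(i in [set: 'I_n]) ass (S i)
      & exists ha : two_sided_ideal a,
          dense [set quotient_pi ha c | c in C]
                (@regular (quotient_ring ha))].
Proof.
split; first exact: semisimple_localization_simple_localizations.
move=> [n [S [_ locS aE [ha densC]]]].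
exact: simple_localizations_semisimple_localization locS aE densC.
Qed.
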